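(* Let $\mathcal{X}$ be a complex Banach space and let $\boldsymbol{A}=(A_1,A_2)$ and $\boldsymbol{B}=(B_1,B_2)$ be commuting pairs of operators in $\mathcal{B}(\mathcal{X})$ (that is, $A_1A_2=A_2A_1$ and $B_1B_2=B_2B_1$). Let $\Delta_{\boldsymbol{A},\boldsymbol{B}}=\mu_{A_1,B_1}-\mu_{A_2,B_2}$, and suppose that $\mathscr{N}(\Delta_{\boldsymbol{A},\boldsymbol{B}})\neq\{0\}$ and $\mathscr{R}(\Delta_{\boldsymbol{A},\boldsymbol{B}})\neq\{0\}$. Suppose that $\mu_{A_1,B_1}$ and $\mu_{A_2,B_2}$ are power-bounded with constants $K_1\geq 1$ and $K_2\geq 1$, respectively. If the restriction $\mu_{A_1,B_1}|_{\mathscr{N}(\Delta_{\boldsymbol{A},\boldsymbol{B}})}$ of $\mu_{A_1,B_1}$ to the null space $\mathscr{N}(\Delta_{\boldsymbol{A},\boldsymbol{B}})$ is power-bounded below with a constant $M>0$, then $$\sin\bigl(\angle\big(\mathscr{N}(\Delta_{\boldsymbol{A},\boldsymbol{B}}),\mathscr{R}(\Delta_{\boldsymbol{A},\boldsymbol{B}})\big)\bigr)\geq\frac{M}{K_1K_2}>0,$$ and consequently $\operatorname{asc}(\Delta_{\boldsymbol{A},\boldsymbol{B}})=1$.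
   Context: $\mathcal{B}(\mathcal{X})$ is the Banach algebra of all bounded linear operators on $\mathcal{X}$. For $A,B\in\mathcal{B}(\mathcal{X})$, $\mu_{A,B}\colon\mathcal{B}(\mathcal{X})\to\mathcal{B}(\mathcal{X})$ is $\mu_{A,B}(X)=AXB$; thus $\Delta_{\boldsymbol{A},\boldsymbol{B}}(X)=A_1XB_1-A_2XB_2$. $\mathscr{N}(T)$ and $\mathscr{R}(T)$ denote the null space and the range of $T$. Since the pairs commute, $\mathscr{N}(\Delta_{\boldsymbol{A},\boldsymbol{B}})$ is invariant under $\mu_{A_1,B_1}$, so the restriction is an operator on the Banach space $\mathscr{N}(\Delta_{\boldsymbol{A},\boldsymbol{B}})$. A bounded operator $T$ is power-bounded with constant $K\geq 1$ if $\|T^n\|\leq K$ for all $n\in\mathbb{N}$. The minimum modulus of $T$ is $m(T)=\inf\{\|Tx\| : \|x\|=1\}$; $T$ is power-bounded below with constant $M>0$ if $M\leq m(T^n)$ for all $n\geq 0$. For nonzero linear submanifolds $\mathscr{K},\mathscr{M}$ of a Banach space, the angle $\angle(\mathscr{K},\mathscr{M})\in[0,\pi/2]$ is defined by $\sin(\angle(\mathscr{K},\mathscr{M}))=\inf\{\|x-y\| : x\in\mathscr{K},\ \|x\|=1,\ y\in\mathscr{M}\}$. The ascent $\operatorname{asc}(T)$ is the smallest non-negative integer $k$ such that $\mathscr{N}(T^k)=\mathscr{N}(T^{k+1})$ (with $T^0=I$), and $\infty$ if no such $k$ exists. *)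

(* Defs.v *)
From HB Require Import structures.
From mathcomp Require Import all_boot all_order all_algebra.
From mathcomp Require Import complex.
From mathcomp Require Import all_classical all_reals all_analysis.

Set Implicit Arguments.
Unset Strict Implicit.
Unset Printing Implicit Defensive.

Import Order.TTheory GRing.Theory Num.Theory.
Import numFieldNormedType.Exports.

Local Open Scope classical_set_scope.
Local Open Scope ring_scope.
Local Open Scope complex_scope.

(* In a normed module over R[i], `|x| is an element of R[i] (a nonnegative
   real one); [rnorm] is the same norm with values in R. *)
Definition rnorm (R : realType) (V : normedModType R[i]) (x : V) : R :=
  complex.Re `|x|.

Section rnorm_theory.
Variables (R : realType) (V : normedModType R[i]).
Implicit Types x y : V.

Lemma rnormE x : `|x| = (rnorm x)%:C.
Proof. by rewrite /rnorm RRe_real // ger0_real. Qed.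

Lemma rnorm_ge0 x : 0 <= rnorm x.
Proof. by rewrite -lecR -rnormE normr_ge0. Qed.

Lemma rnorm0 : rnorm (0 : V) = 0.
Proof. by apply/complexI; rewrite -rnormE normr0. Qed.

Lemma rnorm_eq0 x : rnorm x = 0 -> x = 0.
Proof. by move=> x0; apply/normr0_eq0; rewrite rnormE x0. Qed.

Lemma rnormD x y : rnorm (x + y) <= rnorm x + rnorm y.
Proof. by rewrite -lecR rmorphD /= -!rnormE ler_normD. Qed.

Lemma rnormZ (a : R[i]) x : rnorm (a *: x) = complex.Re `|a| * rnorm x.
Proof.
by apply/complexI; rewrite rmorphM /= -!rnormE normrZ.
Qed.

End rnorm_theory.

Section bounded_operators.
Variables (R : realType) (V : normedModType R[i]).

Definition bounded_linear : {pred V -> V} := fun f =>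
  `[< linear f /\ exists C : R, forall x, rnorm (f x) <= C * rnorm x >].

(* The algebra of bounded linear operators on V. *)
Record bop := Bop { bop_fun :> V -> V; _ : bop_fun \in bounded_linear }.

HB.instance Definition _ := [isSub for bop_fun].
HB.instance Definition _ := [Choice of bop by <:].

Lemma bop_linear (T : bop) : linear T.
Proof. by case: T => f /= /asboolP[]. Qed.

HB.instance Definition _ (T : bop) :=
  GRing.isLinear.Build R[i] V V _ T (bop_linear T).

Lemma bop_bounded (T : bop) :
  exists2 C : R, 0 <= C & forall x, rnorm (T x) <= C * rnorm x.
Proof.
case: T => f /= /asboolP[_ [C fC]]; exists `|C| => // x.
by rewrite (le_trans (fC x))// ler_wpM2r ?rnorm_ge0// ler_norm.
Qed.

Lemma bopP (S T : bop) : S =1 T -> S = T.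
Proof. by move=> ST; apply/val_inj/funext. Qed.

Lemma bounded_linear_submod : submod_closed bounded_linear.
Proof.
split=> [|a f g /asboolP[lf [C fC]] /asboolP[lg [D gD]]].
  apply/asboolP; split; first by move=> a x y; rewrite /= scaler0 addr0.
  by exists 0 => x; rewrite mul0r rnorm0.
apply/asboolP; split.
  move=> b x y; rewrite -![(a *: f + g) _]/(a *: f _ + g _) lf lg.
  rewrite !scalerDr !scalerA [a * b]mulrC -!addrA; congr (_ + _).
  by rewrite addrCA.
exists (complex.Re `|a| * C + D) => x.
rewrite -[(a *: f + g) x]/(a *: f x + g x) mulrDl (le_trans (rnormD _ _))//.
rewrite lerD// rnormZ -mulrA ler_wpM2l//.
by rewrite -lecR RRe_real ?normr_ge0// ger0_real.
Qed.

HB.instance Definition _ :=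
  GRing.isSubmodClosed.Build R[i] (V -> V) bounded_linear
    bounded_linear_submod.
HB.instance Definition _ := [SubChoice_isSubLmodule of bop by <:].

Lemma id_bounded_linear : idfun \in bounded_linear.
Proof. by apply/asboolP; split=> //; exists 1 => x; rewrite mul1r. Qed.

Lemma comp_bounded_linear (S T : bop) : S \o T \in bounded_linear.
Proof.
apply/asboolP; split=> [a x y|]; first by rewrite /= !linearP.
have [[C C0 SC] [D _ TD]] := (bop_bounded S, bop_bounded T).
exists (C * D) => x; rewrite /= (le_trans (SC _))// -mulrA.
by rewrite ler_wpM2l.
Qed.

Definition bop_one : bop := Bop id_bounded_linear.
Definition bop_mul (S T : bop) : bop := Bop (comp_bounded_linear S T).

Lemma bop_mulA : associative bop_mul.
Proof. by move=> S T U; exact: bopP. Qed.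
Lemma bop_mul1l : left_id bop_one bop_mul.
Proof. by move=> S; exact: bopP. Qed.
Lemma bop_mul1r : right_id bop_one bop_mul.
Proof. by move=> S; exact: bopP. Qed.
Lemma bop_mulDl : left_distributive bop_mul +%R.
Proof. by move=> S T U; exact: bopP. Qed.
Lemma bop_mulDr : right_distributive bop_mul +%R.
Proof. by move=> S T U; apply: bopP => x /=; rewrite linearD. Qed.

(* Multiplication is composition; the ring may be trivial (when V is). *)
HB.instance Definition _ := GRing.Zmodule_isPzRing.Build bop
  bop_mulA bop_mul1l bop_mul1r bop_mulDl bop_mulDr.

Definition opnorm (T : bop) : R :=
  sup [set rnorm (T x) | x in [set x | rnorm x <= 1]].

Lemma opnorm_has_sup (T : bop) :
  has_sup [set rnorm (T x) | x in [set x | rnorm x <= 1]].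
Proof.
split; first by exists (rnorm (T 0)), 0 => //=; rewrite rnorm0.
have [C C0 TC] := bop_bounded T; exists C => _ [x /= x1 <-].
by rewrite (le_trans (TC x))// ler_piMr.
Qed.

Lemma opnorm_ub (T : bop) x : rnorm x <= 1 -> rnorm (T x) <= opnorm T.
Proof.
by move=> x1; apply: ub_le_sup; [case: (opnorm_has_sup T)|exists x].
Qed.

Lemma opnorm_le (T : bop) (C : R) :
  (forall x, rnorm x <= 1 -> rnorm (T x) <= C) -> opnorm T <= C.
Proof.
move=> TC; apply: ge_sup; first by case: (opnorm_has_sup T).
by move=> _ [x /= x1 <-]; exact: TC.
Qed.

Lemma opnorm_ge0 (T : bop) : 0 <= opnorm T.
Proof.
apply: (le_trans (rnorm_ge0 (T 0))).
by apply: opnorm_ub; rewrite rnorm0.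
Qed.

Lemma rnorm_bop_le (T : bop) x : rnorm (T x) <= opnorm T * rnorm x.
Proof.
have [->|x0] := eqVneq x 0; first by rewrite linear0 !rnorm0 mulr0.
have nx0 : 0 < rnorm x.
  rewrite lt_neqAle rnorm_ge0 andbT eq_sym.
  by apply: contra x0 => /eqP/rnorm_eq0 ->.
have Ra : complex.Re `|((rnorm x)^-1)%:C : R[i]| = (rnorm x)^-1.
  by rewrite ger0_norm// lecR invr_ge0 ltW.
have := @opnorm_ub T (((rnorm x)^-1)%:C *: x).
rewrite linearZ /= !rnormZ Ra mulVf ?gt_eqF// => /(_ (lexx _)).
by rewrite mulrC ler_pdivrMr.
Qed.

Definition bop_norm (T : bop) : R[i] := (opnorm T)%:C.

Lemma bop_normD (S T : bop) : bop_norm (S + T) <= bop_norm S + bop_norm T.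
Proof.
rewrite /bop_norm -rmorphD lecR; apply: opnorm_le => x x1.
rewrite -[(S + T) x]/(S x + T x) (le_trans (rnormD _ _))//.
by rewrite lerD// opnorm_ub.
Qed.

Lemma bop_normZ_le (a : R[i]) (T : bop) :
  opnorm (a *: T) <= complex.Re `|a| * opnorm T.
Proof.
apply: opnorm_le => x x1; rewrite -[(a *: T) x]/(a *: T x) rnormZ.
rewrite ler_wpM2l ?opnorm_ub//.
by rewrite -lecR RRe_real ?normr_ge0// ger0_real.
Qed.

Lemma bop_normZ (a : R[i]) (T : bop) : bop_norm (a *: T) = `|a| * bop_norm T.
Proof.
have aR (b : R[i]) : `|b| = (complex.Re `|b|)%:C.
  by rewrite RRe_real// ger0_real.
rewrite aR /bop_norm -rmorphM; congr (_%:C); apply/eqP; rewrite eq_le.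
rewrite bop_normZ_le andTb; have [->|a0] := eqVneq a 0.
  by rewrite normr0 mul0r opnorm_ge0.
have Ra : 0 < complex.Re `|a| by rewrite -ltcR -aR normr_gt0.
rewrite mulrC -ler_pdivlMr// -{1}[T]scale1r -(mulVf a0) -scalerA.
rewrite (le_trans (bop_normZ_le _ _))// mulrC ler_wpM2l ?opnorm_ge0//.
rewrite -lecR -aR normfV {1}aR -(@fmorphV _ _ (real_complex R)).
by [].
Qed.

Lemma bop_norm_eq0 (T : bop) : bop_norm T = 0 -> T = 0.
Proof.
move=> /complexI T0; apply: bopP => x; apply/rnorm_eq0/eqP.
by rewrite eq_le rnorm_ge0 andbT (le_trans (rnorm_bop_le T x))// T0 mul0r.
Qed.

HB.instance Definition _ := Lmodule_isNormed.Build R[i] bop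
  bop_normD bop_normZ bop_norm_eq0.

End bounded_operators.

Section operator_notions.
Variables (R : realType) (V : normedModType R[i]).
Implicit Types (T S : bop V) (K M : set V).

Definition nullspace T : set V := [set x | T x = 0].

Definition power_bounded T (k : R) := forall n : nat, rnorm (T ^+ n) <= k.

(* On the zero space the infimum is over the empty set and is 0 here. *)
Definition min_modulus T : R :=
  inf [set rnorm (T x) | x in [set x | rnorm x = 1]].

Definition power_bounded_below T (m : R) :=
  forall n : nat, m <= min_modulus (T ^+ n).

(* For K, M nonzero the infimum lies in [0, 1], so that this is the angle in
   [0, pi/2] having it as its sine. *)
Definition angle K M : R :=
  asin (inf [set rnorm (p.1 - p.2) |
             p in [set p | [/\ K p.1, rnorm p.1 = 1 & M p.2]]]).

Definition null_stable T : pred nat :=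
  fun k => `[< nullspace (T ^+ k) = nullspace (T ^+ k.+1) >].

(* [None] stands for an infinite ascent. *)
Definition ascent T : option nat :=
  if pselect (exists k, null_stable T k) is left h then Some (ex_minn h)
  else None.

End operator_notions.

(* The null space of an operator as a normed space in its own right. *)
Section null_space_type.
Variables (R : realType) (V : normedModType R[i]) (T : bop V).

Definition null_pred : {pred V} := fun x => x \in nullspace T.

Record null_type := NullType { null_val :> V; _ : null_val \in null_pred }.

HB.instance Definition _ := [isSub for null_val].
HB.instance Definition _ := [Choice of null_type by <:].

Lemma null_predP x : reflect (T x = 0) (x \in null_pred).
Proof. by apply: (iffP idP) => [/set_mem|Tx]//; exact/mem_set. Qed.

Lemma null_pred_submod : submod_closed null_pred.
Proof.
split=> [|a x y]; first by apply/null_predP; rewrite linear0.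
move=> /null_predP x0 /null_predP y0; apply/null_predP.
by rewrite linearP/= x0 y0 scaler0 addr0.
Qed.

HB.instance Definition _ :=
  GRing.isSubmodClosed.Build R[i] V null_pred null_pred_submod.
HB.instance Definition _ := [SubChoice_isSubLmodule of null_type by <:].

Definition null_norm (x : null_type) : R[i] := `|null_val x|.

Lemma null_normD (x y : null_type) :
  null_norm (x + y) <= null_norm x + null_norm y.
Proof. exact: ler_normD. Qed.
Lemma null_normZ (a : R[i]) (x : null_type) :
  null_norm (a *: x) = `|a| * null_norm x.
Proof. exact: normrZ. Qed.
Lemma null_norm_eq0 (x : null_type) : null_norm x = 0 -> x = 0.
Proof. by move/normr0_eq0 => x0; exact: val_inj. Qed.

HB.instance Definition _ := Lmodule_isNormed.Build R[i] null_type
  null_normD null_normZ null_norm_eq0.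

Variables (S : bop V) (ST : S * T = T * S).

Lemma null_invariant (x : null_type) : S x \in null_pred.
Proof.
case: x => x /= /null_predP Tx; apply/null_predP.
by rewrite -[T (S x)]/((T * S) x) -ST -[(S * T) x]/(S (T x)) Tx linear0.
Qed.

Definition null_restr_fun (x : null_type) : null_type :=
  NullType (null_invariant x).

Lemma null_restr_bounded_linear : null_restr_fun \in @bounded_linear R null_type.
Proof.
apply/asboolP; split=> [a x y|].
  by apply: val_inj; rewrite /= linearP.
by have [C _ SC] := bop_bounded S; exists C => x; exact: SC.
Qed.

(* The restriction of S to the null space of T, for S commuting with T. *)
Definition null_restr : bop null_type := Bop null_restr_bounded_linear.

End null_space_type.

Section elementary_operators.
Variables (R : realType) (V : normedModType R[i]).

Lemma mu_bounded_linear (A B : bop V) :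
  (fun X : bop V => A * X * B) \in @bounded_linear R (bop V).
Proof.
apply/asboolP; split=> [a X Y|].
  by apply: bopP => x; exact: (linearP A).
have mulle (S T : bop V) : rnorm (S * T) <= rnorm S * rnorm T.
  apply: opnorm_le => x x1; rewrite -[(S * T) x]/(S (T x)).
  rewrite (le_trans (rnorm_bop_le _ _))// ler_wpM2l ?opnorm_ge0//.
  exact: opnorm_ub.
exists (rnorm A * rnorm B) => X; rewrite (le_trans (mulle _ _))//.
by rewrite mulrAC ler_wpM2r ?rnorm_ge0.
Qed.

Definition mu (A B : bop V) : bop (bop V) := Bop (mu_bounded_linear A B).

Definition Delta (A B : bop V * bop V) : bop (bop V) :=
  mu A.1 B.1 - mu A.2 B.2.

Lemma mu_mul (A B C D : bop V) : mu A B * mu C D = mu (A * C) (D * B).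
Proof.
by apply: bopP => X; rewrite -[LHS]/(A * (C * X * D) * B) /= !mulrA.
Qed.

Lemma mu_Delta_comm (A B : bop V * bop V) :
  A.1 * A.2 = A.2 * A.1 -> B.1 * B.2 = B.2 * B.1 ->
  mu A.1 B.1 * Delta A B = Delta A B * mu A.1 B.1.
Proof.
by move=> hA hB; rewrite /Delta mulrBr mulrBl !mu_mul hA hB.
Qed.

End elementary_operators.

(* Main.v *)
(* Put S = mu_{A_1,B_1}, T = mu_{A_2,B_2} and D = S - T, where S and T commute,
   and let W_n = \sum_(i < n) S^(n-1-i) T^i.  Then W_n D = S^n - T^n, while
   W_n x = n S^(n-1) x for x in N(D).  Hence, for a unit vector x in N(D) and
   any z,
     n M <= |n S^(n-1) x| <= |W_n (x - D z)| + |(S^n - T^n) z|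
         <= n K_1 K_2 |x - D z| + (K_1 + K_2) |z|;
   dividing by n and letting n go to infinity gives the bound on the angle.  In
   particular N(D) and R(D) only meet in 0, so that N(D^2) = N(D). *)
Require Import Defs.
From mathcomp Require Import all_boot all_order all_algebra.
From mathcomp Require Import complex.
From mathcomp Require Import all_classical all_reals all_analysis.

Import Order.TTheory GRing.Theory Num.Theory.
Import numFieldNormedType.Exports.

Local Open Scope classical_set_scope.
Local Open Scope ring_scope.
Local Open Scope complex_scope.

(** If [b < a], an [n] larger than [c / (a - b)] violates the hypothesis. This replaces dividing by
    [n] and passing to the limit. *)
Lemma archimedean_le (R : archiRealFieldType) (a b c : R) :
  (forall n : nat, n%:R * a <= n%:R * b + c) -> a <= b.
Proof.
move=> h; rewrite leNgt; apply/negP => ba.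
have ab0 : 0 < a - b by rewrite subr_gt0.
have := h (Num.bound `|c / (a - b)|); rewrite -lerBlDl -mulrBr leNgt.
rewrite -ltr_pdivrMr// => /negP; apply.
exact: le_lt_trans (ler_norm _) (archi_boundP (normr_ge0 _)).
Qed.

Lemma min_modulus_le (R : realType) (V : normedModType R[i])
    (T : bop V) (x : V) :
  rnorm x = 1 -> min_modulus T <= rnorm (T x).
Proof.
move=> x1; apply: ge_inf; last by exists x.
by exists 0 => _ [y _ <-]; exact: rnorm_ge0.
Qed.

Section bounded_operators.
Context {R : realType} {V : normedModType R[i]}.
Implicit Types (S T D : bop V) (x y z : V).

Lemma rnormN x : rnorm (- x) = rnorm x.
Proof. by rewrite /rnorm normrN. Qed.

Lemma rnorm_mulrn x n : rnorm (x *+ n) = n%:R * rnorm x.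
Proof.
by apply: complexI; rewrite rmorphM /= rmorph_nat -!rnormE normrMn mulr_natl.
Qed.

Lemma rnorm_sum (I : Type) (r : seq I) (F : I -> V) :
  rnorm (\sum_(i <- r) F i) <= \sum_(i <- r) rnorm (F i).
Proof.
elim/big_ind2 : _ => // [|x a y b xa yb]; first by rewrite rnorm0.
by rewrite (le_trans (rnormD _ _))// lerD.
Qed.

Lemma exists_unit_scale {x} : x <> 0 -> exists a : R[i], rnorm (a *: x) = 1.
Proof.
move=> x0; have nx0 : rnorm x != 0 by apply/eqP => /rnorm_eq0.
exists (rnorm x)^-1%:C; rewrite rnormZ.
by rewrite ger0_norm ?lecR ?invr_ge0 ?rnorm_ge0//= mulVf.
Qed.

Lemma bop_sumE (I : Type) (r : seq I) (F : I -> bop V) x :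
  (\sum_(i <- r) F i) x = \sum_(i <- r) F i x.
Proof. exact: (big_morph (fun T : bop V => T x)). Qed.

Lemma rnorm_power_le {T} {k : R} : power_bounded T k ->
  forall n x, rnorm ((T ^+ n) x) <= k * rnorm x.
Proof.
move=> Tk n x; rewrite (le_trans (rnorm_bop_le _ _))//.
by rewrite ler_wpM2r ?rnorm_ge0//; exact: Tk.
Qed.

Lemma nullspace_unit {T} :
  nullspace T <> [set 0] -> exists2 x, nullspace T x & rnorm x = 1.
Proof.
move=> T0; have [x [Tx x0]] : exists x, T x = 0 /\ x <> 0.
  apply: contrapT => nex; apply: T0; apply/seteqP; split=> [x Tx|_ ->].
    by apply: contrapT => x0; apply: nex; exists x.
  exact: linear0.
have [a ax1] := exists_unit_scale x0; exists (a *: x) => //.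
by rewrite /nullspace /= linearZ /= Tx scaler0.
Qed.

Lemma null_restr_powE {D S} (SD : S * D = D * S) n (x : null_type D) :
  null_val ((null_restr SD ^+ n) x) = (S ^+ n) (null_val x).
Proof.
by elim: n x => [//|n IH] x; rewrite !exprSr; exact: (IH (null_restr SD x)).
Qed.

(** A unit vector of [V] killed by [D] is a unit vector of [null_type D], whose norm is inherited,
    so the minimum modulus of the restricted power applies to it. *)
Lemma power_bounded_below_null_restr {D S} {SD : S * D = D * S} {m : R} :
  power_bounded_below (null_restr SD) m ->
  forall n x, D x = 0 -> rnorm x = 1 -> m <= rnorm ((S ^+ n) x).
Proof.
move=> Sm n x Dx x1; have xD : x \in null_pred D by exact/null_predP.
apply: (le_trans (Sm n)); rewrite -[x]/(null_val (NullType xD)).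
rewrite -(null_restr_powE SD).
exact: (min_modulus_le _ (null_type D) _ (NullType xD) x1).
Qed.

(** Induction on [n]: T S^n x = S^n T x = S^n S x. *)
Lemma eq_pow_null {S T x} : GRing.comm S T -> (S - T) x = 0 ->
  forall n, (T ^+ n) x = (S ^+ n) x.
Proof.
move=> ST /eqP; rewrite -[(S - T) x]/(S x - T x) subr_eq0 => /eqP STx.
elim=> [//|n IH]; rewrite exprS -[LHS]/(T ((T ^+ n) x)) IH.
rewrite -[LHS]/((T * S ^+ n) x) (commrX n (commr_sym ST)).
by rewrite exprSr -[LHS]/((S ^+ n) (T x)) -STx.
Qed.

Lemma dist_null_range {S T} {K1 K2 M : R} : GRing.comm S T ->
  power_bounded S K1 -> power_bounded T K2 -> 0 <= K1 ->
  forall x z, (S - T) x = 0 -> (forall n, M <= rnorm ((S ^+ n) x)) ->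
  M <= K1 * K2 * rnorm (x - (S - T) z).
Proof.
move=> ST SK TK K1ge0 x z Dx Mx.
(* The additive constant bounds |(S^n - T^n) z| uniformly in [n]. *)
apply: (@archimedean_le _ _ _ ((K1 + K2) * rnorm z)) => n.
pose W := \sum_(i < n) S ^+ (n.-1 - i) * T ^+ i.
have Wx : W x = (S ^+ n.-1) x *+ n.
  rewrite bop_sumE -[X in _ *+ X]card_ord -sumr_const.
  apply: eq_bigr => i _.
  rewrite -[LHS]/((S ^+ (n.-1 - i)) ((T ^+ i) x)) (eq_pow_null ST Dx).
  (* The truncated subtraction is exact because [i <= n.-1]; for [n = 0] there is no index [i]. *)
  rewrite -[LHS]/((S ^+ (n.-1 - i) * S ^+ i) x) -exprD subnK//.
  by case: n i {W} => [[]//|n] i; exact: (ltn_ord i).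
have WD : W * (S - T) = S ^+ n - T ^+ n.
  (* The factorization [subrXX_comm] has [S - T] on the left of the sum, while [W] must act after it
     here. *)
  have STW : GRing.comm W (S - T).
    apply: commr_sym; apply: commr_sum => i _.
    by apply: commrM; apply: commrX; apply: commr_sym; apply: commrB;
      rewrite /GRing.comm ?ST.
  by rewrite STW subrXX_comm.
have WDz : W ((S - T) z) = (S ^+ n) z - (T ^+ n) z.
  by rewrite -[LHS]/((W * (S - T)) z) WD.
have Wle y : rnorm (W y) <= n%:R * (K1 * K2 * rnorm y).
  rewrite bop_sumE (le_trans (rnorm_sum _ _ _))// mulr_natl.
  rewrite -[X in _ *+ X]card_ord -sumr_const; apply: ler_sum => i _.
  rewrite -mulrA (le_trans (rnorm_power_le SK _ _))// ler_wpM2l//.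
  exact: rnorm_power_le.
have nM : n%:R * M <= rnorm (W x).
  by rewrite Wx rnorm_mulrn ler_wpM2l// ler0n.
apply: (le_trans nM).
have <- : W (x - (S - T) z) + ((S ^+ n) z - (T ^+ n) z) = W x.
  by rewrite linearB /= WDz subrK.
rewrite (le_trans (rnormD _ _))// lerD//.
rewrite (le_trans (rnormD _ _))// rnormN mulrDl.
by rewrite lerD// rnorm_power_le.
Qed.

Lemma ascent_eq1 {T} : nullspace T <> [set 0] ->
  (forall x, T (T x) = 0 -> T x = 0) -> ascent T = Some 1%N.
Proof.
move=> T0 TT; have stable1 : null_stable T 1.
  apply/asboolP/seteqP; split=> x; last exact: TT.
  by move=> Tx; apply: (etrans (congr1 T Tx)); exact: linear0.
rewrite /ascent; case: pselect => [ex|[]]; last by exists 1%N.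
(* Minimality excludes values above 1; the value 0 would give N(T) = N(I) = {0}. *)
case: ex_minnP => -[|[//|n]] stab min; last by have := min _ stable1.
case: T0; rewrite -[T]expr1; move/asboolP : stab => <-.
by apply/seteqP; split.
Qed.

End bounded_operators.

Theorem theorem2 (R : realType) (X : completeNormedModType R[i])
    (A B : bop X * bop X)
    (hA : A.1 * A.2 = A.2 * A.1) (hB : B.1 * B.2 = B.2 * B.1)
    (hN : nullspace (Delta A B) <> [set 0])
    (hR : range (Delta A B) <> [set 0])
    (K1 K2 : R) (hK1 : 1 <= K1) (hK2 : 1 <= K2)
    (hpb1 : power_bounded (mu A.1 B.1) K1)
    (hpb2 : power_bounded (mu A.2 B.2) K2)
    (M : R) (hM : 0 < M)
    (hpbb : power_bounded_below (null_restr (mu_Delta_comm hA hB)) M) :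
  [/\ M / (K1 * K2) <= sin (angle (nullspace (Delta A B)) (range (Delta A B))),
      0 < M / (K1 * K2)
    & ascent (Delta A B) = Some 1%N].
Proof.
have K1gt0 : 0 < K1 by exact: lt_le_trans hK1.
have K2gt0 : 0 < K2 by exact: lt_le_trans hK2.
have Kgt0 : 0 < K1 * K2 by exact: mulr_gt0.
have c0 : 0 < M / (K1 * K2) by exact: divr_gt0.
have comm : GRing.comm (mu A.1 B.1) (mu A.2 B.2).
  by rewrite /GRing.comm !mu_mul hA hB.
have dist x z : nullspace (Delta A B) x -> rnorm x = 1 ->
    M / (K1 * K2) <= rnorm (x - Delta A B z).
  move=> Dx x1; rewrite ler_pdivrMr// mulrC.
  apply: (dist_null_range comm hpb1 hpb2 (ltW K1gt0)) => // n.
  exact: power_bounded_below_null_restr hpbb n x Dx x1.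
split=> //.
- rewrite /angle; set E := (X in inf X); have [u Du u1] := nullspace_unit hN.
  (* The pair [(u, 0)] makes [E] nonempty and gives [inf E <= 1], which [asinK] needs besides
     [-1 <= inf E]. *)
  have E1 : E 1.
    exists (u, 0); last by rewrite /= subr0.
    by split=> //; exists 0 => //; exact: linear0.
  have cE : lbound E (M / (K1 * K2)).
    by move=> _ [[x _] /= [Dx x1 [z _ <-]] <-]; exact: dist.
  have cinf : M / (K1 * K2) <= inf E by apply: lb_le_inf => //; exists 1.
  have inf1 : inf E <= 1 by apply: ge_inf => //; exists (M / (K1 * K2)).
  rewrite asinK// in_itv /= inf1 andbT (le_trans _ cinf)//.
  by rewrite (le_trans _ (ltW c0))// lerN10.
(* If D x were nonzero, the unit vector a D x = D (a x) would lie in both N(D) and R(D), at distance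
   0 from the range, against [dist]. *)
- apply: (ascent_eq1 hN) => x DDx; apply: contrapT => /exists_unit_scale[a ax1].
  have DZ y : Delta A B (a *: y) = a *: Delta A B y by exact: linearZ.
  have Day : Delta A B (a *: Delta A B x) = 0 by rewrite DZ DDx scaler0.
  have := dist _ (a *: x) Day ax1; rewrite DZ subrr rnorm0.
  by rewrite leNgt c0.
Qed.
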